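(* Let $\rho\in(0,\pi]$ and $h>0$. Let $P$ be a probability measure on $\mathbb{R}^d$, absolutely continuous with respect to the Lebesgue measure $\mu$, with compact support $S$. Let $X_1,X_2,\ldots$ be i.i.d. with distribution $P$ and denote $\aleph_n=\{X_1,\ldots,X_n\}$. Let $\nu$ be any Borel measure on $\mathbb{R}^d$, finite on compact sets, whose restriction to $S$ is absolutely continuous with respect to $P$. (a) If $S\in\mathcal{C}_{\rho,h}$ (i.e. $S$ is $\rho,h$-cone-convex), then the sequence $\mathbb{C}_{\rho,h}(\aleph_n)$ of $\rho,h$-cone-convex hulls of $\aleph_n$ fulfills $$d_H\big(\mathbb{C}_{\rho,h}(\aleph_n),S\big)\to 0\ \text{ a.s.}\qquad\text{and}\qquad d_\nu\big(\mathbb{C}_{\rho,h}(\aleph_n),S\big)\to 0\ \text{ a.s.}$$ (b) If $S\in\tilde{\mathcal{C}}_{\rho,h}$ (i.e. $S$ is $\rho,h$-cone-convex by complement), then the sequence $\tilde{\mathbb{C}}_{\rho,h}(\aleph_n)$ of $\rho,h$-cone-convex hulls by complement fulfills $$d_H\big(\tilde{\mathbb{C}}_{\rho,h}(\aleph_n),S\big)\to 0\ \text{ a.s.}\qquad\text{and}\qquad d_\nu\big(\tilde{\mathbb{C}}_{\rho,h}(\aleph_n),S\big)\to 0\ \text{ a.s.}$$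
   Context: $B(x,h)$ denotes the open Euclidean ball in $\mathbb{R}^d$. For $x\in\mathbb{R}^d$, a unit vector $\xi$, $\rho\in(0,\pi]$ and $h>0$, the finite open cone is $$C_{\rho,\xi,h}(x)=B(x,h)\cap\Big\{z\in\mathbb{R}^d,\ z\ne x:\ \Big\langle \xi,\frac{z-x}{\|z-x\|}\Big\rangle>\cos(\rho/2)\Big\}.$$ $\mathcal{C}_{\rho,h}$ is the class of nonempty compact sets $S\subset\mathbb{R}^d$ such that for every $x\in\partial S$ there is a unit vector $\xi$ with $C_{\rho,\xi,h}(x)\subset S^c$. $\tilde{\mathcal{C}}_{\rho,h}$ is the class of nonempty compact sets $S\subset\mathbb{R}^d$ such that $S$ equals the intersection of the complements of all cones $C_{\rho,\xi,h}(y)$ ($y\in\mathbb{R}^d$, $\|\xi\|=1$) disjoint from $S$. For a bounded set $A\subset\mathbb{R}^d$, the cone-convex hull $\mathbb{C}_{\rho,h}(A)$ is the intersection of all sets $B\in\mathcal{C}_{\rho,h}$ with $A\subset B$; the cone-convex hull by complement $\tilde{\mathbb{C}}_{\rho,h}(A)$ is the intersection of the complements of all cones $C_{\rho,\xi,h}(y)$ disjoint from $A$ (equivalently, the intersection of all $B\in\tilde{\mathcal{C}}_{\rho,h}$ with $A\subset B$). $d_H$ is the Hausdorff distance between nonempty compact sets, and $d_\nu(A,C)=\nu(A\setminus C)+\nu(C\setminus A)$. *)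

(* Defs.v *)
From HB Require Import structures.
From mathcomp Require Import all_boot all_order all_algebra finmap.
From mathcomp Require Import all_classical all_reals all_analysis measurable_realfun.
From mathcomp Require Import lra.

Set Implicit Arguments.
Unset Strict Implicit.
Unset Printing Implicit Defensive.
Import Order.TTheory GRing.Theory Num.Theory.
Import numFieldNormedType.Exports.

Local Open Scope classical_set_scope.
Local Open Scope ring_scope.

(* Matrices carry the Borel sigma-algebra of their canonical (product) topology. *)
HB.instance Definition _ (R : realType) m n :=
  @isMeasurable.Build (sigma_display (@open 'M[R]_(m, n))) 'M[R]_(m, n)
    <<s @open 'M[R]_(m, n) >> (@sigma_algebra0 _ setT _) (@sigma_algebraC _ _)
    (@sigma_algebra_bigcup _ setT _).

Section borel.
Context {R : realType}.

Lemma rV_open_measurable n (U : set 'rV[R]_n) : open U -> measurable U.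
Proof. exact: sub_sigma_algebra. Qed.

Lemma rV_measurable_coord n (i : 'I_n) :
  measurable_fun setT (fun v : 'rV[R]_n => (v 0 i : measurableTypeR R)).
Proof.
apply: (measurability _ (RGenOpens.measurableE R)).
move=> _ [_ [a [b ->] <-]]; rewrite setTI; apply: rV_open_measurable.
apply: open_comp; last exact: interval_open.
by move=> v _; apply: coord_continuous.
Qed.

Lemma measurable_fun_rV d (T : measurableType d) n (f : T -> 'rV[R]_n) :
  (forall i, measurable_fun setT (fun x => (f x 0 i : measurableTypeR R))) ->
  measurable_fun setT f.
Proof.
move=> mf; apply: (@measurability _ _ _ _ _ _ (@open 'rV[R]_n)) => //.
move=> _ [U oU <-]; rewrite setTI.
pose B (p : 'rV[rat]_n * rat) : set 'rV[R]_n :=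
  [set v | forall i, `|v 0 i - ratr (p.1 0 i)| < ratr p.2].
have -> : U = \bigcup_(p in [set p | B p `<=` U]) B p.
  apply/seteqP; split => [v Uv|v [p pU]]; last exact: pU.
  have : nbhs v U by exact: open_nbhs_nbhs.
  rewrite -nbhs_ballE => -[e /= e0 veU].
  have [r /andP[r0 re]] : exists r : rat, (0 : R) < ratr r < e / 2.
    have /rat_in_itvoo[r] : (0 : R) < e / 2 by rewrite divr_gt0.
    by rewrite in_itv /= => ?; exists r.
  have [q qP] : {q : 'I_n -> rat & forall i, `|v 0 i - ratr (q i)| < ratr r}.
    apply: (@choice _ _ (fun i x => `|v 0 i - ratr x| < ratr r)) => i.
    have /rat_in_itvoo[q] : v 0 i - ratr r < v 0 i + ratr r by lra.
    by rewrite in_itv /= => qv; exists q; rewrite ltr_distlC.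
  exists (\row_i q i, r) => /=; last by move=> i; rewrite mxE.
  move=> w wB; apply: veU; split=> // i j; rewrite ord1 /ball /=.
  have := wB j; rewrite mxE; have := qP j => qv qw.
  rewrite -(subrK (ratr (q j)) (v 0 j)) -addrA (le_lt_trans (ler_normD _ _))//.
  by rewrite [X in _ + X]distrC; lra.
rewrite preimage_bigcup bigcup_mkcond; apply: countable_bigcupT_measurable.
  exact: countableP.
move=> p; case: ifPn => // _; rewrite [X in measurable X](_ : _ =
  \bigcap_(i in setT) ((fun x => f x 0 i : measurableTypeR R) @^-1`
    [set x : R | `|x - ratr (p.1 0 i)| < ratr p.2])); last first.
  by apply/seteqP; split=> [x Bx i _|x Bx i]; exact: Bx.
apply: fin_bigcap_measurable => // i _; rewrite -[X in measurable X]setTI.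
apply: mf => //; apply: open_measurable.
rewrite (_ : mkset _ = ball (ratr (p.1 0 i) : R) (ratr p.2)); last first.
  by apply/seteqP; split=> x; rewrite /ball /= distrC.
exact: ball_open.
Qed.

Definition rV_cons n (p : measurableTypeR R * 'rV[R]_n) : 'rV[R]_n.+1 :=
  \row_i oapp (fun j => p.2 0 j) p.1 (unlift ord0 i).

Lemma rV_cons0 n p : @rV_cons n p 0 ord0 = p.1.
Proof. by rewrite mxE unlift_none. Qed.

Lemma rV_consS n p i : @rV_cons n p 0 (lift ord0 i) = p.2 0 i.
Proof. by rewrite mxE liftK. Qed.

Lemma measurable_rV_cons n : measurable_fun setT (@rV_cons n).
Proof.
apply: measurable_fun_rV => i; case: (unliftP ord0 i) => [j|] ->.
  under eq_fun do rewrite rV_consS.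
  exact: (measurableT_comp (@rV_measurable_coord n j)).
under eq_fun do rewrite rV_cons0. exact: measurable_fst.
Qed.

End borel.

Section lebesgue_rV_succ.
Context {R : realType} (n : nat).
Variable mu : {sigma_finite_measure set 'rV[R]_n -> \bar R}.
Local Open Scope ereal_scope.

Definition lebesgue_rV_succ : set 'rV[R]_n.+1 -> \bar R :=
  pushforward (@lebesgue_measure R \x mu) (@rV_cons R n).

Let succ0 : lebesgue_rV_succ set0 = 0.
Proof. by rewrite /lebesgue_rV_succ /pushforward preimage_set0 measure0. Qed.

Let succ_ge0 A : 0 <= lebesgue_rV_succ A.
Proof. by rewrite /lebesgue_rV_succ /pushforward; exact: measure_ge0. Qed.

Let succ_sigma_additive : semi_sigma_additive lebesgue_rV_succ.
Proof.
exact: (@measure_semi_sigma_additive _ _ _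
  (measure_function_pushforward__canonical__measure_function_Measure
    (@lebesgue_measure R \x mu) (@measurable_rV_cons R n))).
Qed.

HB.instance Definition _ := isMeasure.Build _ _ _ lebesgue_rV_succ
  succ0 succ_ge0 succ_sigma_additive.

Let succ_sigma_finite : sigma_finite setT lebesgue_rV_succ.
Proof.
have /sigma_finiteP[F [TF ndF Foo]] := sigma_finiteT (@lebesgue_measure R).
have /sigma_finiteP[G [TG ndG Goo]] := sigma_finiteT mu.
pose uncons (v : 'rV[R]_n.+1) : measurableTypeR R * 'rV[R]_n :=
  (v 0%R ord0, (\row_i v 0 (lift ord0 i))%R).
have munc : measurable_fun setT uncons.
  apply: measurable_fun_pair; first exact: rV_measurable_coord.
  apply: measurable_fun_rV => i; under eq_fun do rewrite mxE.
  exact: rV_measurable_coord.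
have consK : cancel (@rV_cons R n) uncons.
  move=> [x v]; rewrite /uncons rV_cons0; congr pair.
  by apply/rowP => i; rewrite mxE rV_consS.
exists (fun k => uncons @^-1` (F k `*` G k)).
  rewrite -preimage_bigcup -[LHS](preimage_setT uncons); congr (_ @^-1` _).
  rewrite -setXTT TF TG predeqE => -[x y]; split.
    move=> [/= [p _ Fpx] [k _ Gky]]; exists (maxn p k) => //; split.
    - by move: x Fpx; exact/subsetPset/ndF/leq_maxl.
    - by move: y Gky; exact/subsetPset/ndG/leq_maxr.
  by move=> [k _ []/= ? ?]; split; exists k.
move=> k; have [mF Fkoo] := Foo k; have [mG Gkoo] := Goo k; split.
  by rewrite -[X in measurable X]setTI; apply: munc => //; exact: measurableX.
rewrite /lebesgue_rV_succ /pushforward -comp_preimage.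
rewrite (_ : uncons \o _ = id) ?preimage_id.
  by rewrite product_measure1E// lte_mul_pinfty// ge0_fin_numE.
by apply/funext => p /=; rewrite consK.
Qed.

HB.instance Definition _ :=
  Measure_isSigmaFinite.Build _ _ _ lebesgue_rV_succ succ_sigma_finite.

End lebesgue_rV_succ.

(* d-dimensional Lebesgue measure, as the d-fold product of one-dimensional Lebesgue
   measure, on the Borel sigma-algebra (see [lebesgue_rV_box]). *)
Fixpoint lebesgue_rV (R : realType) (d : nat) :
    {sigma_finite_measure set 'rV[R]_d -> \bar R} :=
  match d with
  | 0 => \d_ (0 : 'rV[R]_0)
  | n.+1 => lebesgue_rV_succ (lebesgue_rV R n)
  end.

Lemma lebesgue_rV_box (R : realType) d (a b : 'rV[R]_d) :
  (forall i, a 0 i <= b 0 i) ->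
  lebesgue_rV R d [set v | forall i, v 0 i \in `[a 0 i, b 0 i] ] =
  (\prod_(i < d) (b 0 i - a 0 i))%:E.
Proof.
elim: d a b => [|d IH] a b ab /=.
  by rewrite big_ord0 diracE mem_set//= => -[].
rewrite /lebesgue_rV_succ /pushforward big_ord_recl /=.
pose tl (w : 'rV[R]_d.+1) : 'rV[R]_d := \row_j w 0 (lift ord0 j).
rewrite [X in (_ \x _)%E X](_ : _ = `[a 0 ord0, b 0 ord0]%classic `*`
    [set v : 'rV[R]_d | forall i, v 0 i \in `[tl a 0 i, tl b 0 i] ]).
  rewrite product_measure1E//; last first.
    rewrite [X in measurable X](_ : _ = \bigcap_(i in setT)
        ((fun v : 'rV[R]_d => (v 0 i : measurableTypeR R)) @^-1`
         `[tl a 0 i, tl b 0 i])); last first.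
      by apply/seteqP; split=> [v Bv i _|v Bv i]; exact: Bv.
    apply: fin_bigcap_measurable => // i _.
    by rewrite -[X in measurable X]setTI; apply: rV_measurable_coord.
  rewrite IH; last by move=> i; rewrite !mxE.
  rewrite [RHS]EFinM; congr (_ * _)%E.
    rewrite [LHS]lebesgue_measure_itv /= lte_fin.
    by have := ab ord0; rewrite le_eqVlt => /predU1P[->|->]; rewrite ?ltxx ?subrr.
  by congr EFin; apply: eq_bigr => i _; rewrite !mxE.
apply/seteqP; split => -[x v] /=.
  move=> Bv; split; first by have := Bv ord0; rewrite rV_cons0.
  by move=> i; have := Bv (lift ord0 i); rewrite rV_consS !mxE.
move=> [xab vab] i; case: (unliftP ord0 i) => [j|] ->; last by rewrite rV_cons0.
by rewrite rV_consS; have := vab j; rewrite !mxE.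
Qed.

Section euclidean.
Context {R : realType} {d : nat}.
Implicit Types (x y xi : 'rV[R]_d) (A B C S : set 'rV[R]_d).

Definition dotp x y : R := \sum_i x 0 i * y 0 i.

(* The library norm on ['rV[R]_d] is the sup norm, hence the separate Euclidean norm.
   Both induce the canonical topology of ['rV[R]_d], in terms of which [open],
   [compact], [closure] and [interior] are understood. *)
Definition enorm x : R := Num.sqrt (dotp x x).

Definition boundary S := closure S `\` S°.

Definition edist x A : \bar R := ereal_inf [set (enorm (x - y))%:E | y in A].

(* Extended-real valued, so that unbounded sets and empty arguments need no convention
   such as [sup A = 0]; finite for nonempty compact sets. *)
Definition hausdorff_dist A C : \bar R :=
  maxe (ereal_sup [set edist a C | a in A]) (ereal_sup [set edist c A | c in C]).

Definition measure_dist (nu : set 'rV[R]_d -> \bar R) A C : \bar R :=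
  (nu (A `\` C) + nu (C `\` A))%E.

Definition cone (rho : R) xi (h : R) x : set 'rV[R]_d :=
  [set z | enorm (z - x) < h] `&`
  [set z | z != x /\ dotp xi ((enorm (z - x))^-1 *: (z - x)) > cos (rho / 2)].

Definition cone_convex (rho h : R) S :=
  [/\ S !=set0, compact S &
      forall x, boundary S x ->
        exists2 xi, enorm xi = 1 & cone rho xi h x `<=` ~` S].

(* The cones C_{rho,xi,h}(y), over all apexes y and unit axes xi, disjoint from A. *)
Definition cones_off (rho h : R) A : set (set 'rV[R]_d) :=
  [set C | exists y xi,
    [/\ enorm xi = 1, C = cone rho xi h y & C `&` A = set0]].

Definition cone_hull_compl (rho h : R) A : set 'rV[R]_d :=
  \bigcap_(C in cones_off rho h A) ~` C.

Definition cone_convex_compl (rho h : R) S :=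
  [/\ S !=set0, compact S & S = cone_hull_compl rho h S].

Definition cone_hull (rho h : R) A : set 'rV[R]_d :=
  \bigcap_(B in [set B | cone_convex rho h B /\ A `<=` B]) B.

Definition measure_support (P : set 'rV[R]_d -> \bar R) : set 'rV[R]_d :=
  [set x | forall U, open U -> U x -> (0 < P U)%E].

End euclidean.

Section random_sample.
Context {R : realType} {d d' : measure_display}.
Context {Omega : measurableType d} {T : measurableType d'} {Pr : probability Omega R}.

Definition mutually_independent (X : nat -> {RV Pr >-> T}) :=
  forall (J : {fset nat}) (A : nat -> set T), (forall i, measurable (A i)) ->
    Pr (\bigcap_(i in [set` J]) (X i @^-1` A i)) =
    (\prod_(i <- J) Pr (X i @^-1` A i))%E.

Definition iid_with_law (P : probability T R) (X : nat -> {RV Pr >-> T}) :=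
  mutually_independent X /\
  forall i A, measurable A -> distribution Pr (X i) A = P A.

(* X_1, X_2, ... are indexed from 0: this is {X_0, ..., X_{n-1}}, with n points. *)
Definition sample (X : nat -> {RV Pr >-> T}) (n : nat) (w : Omega) : set T :=
  [set X i w | i in `I_n].

End random_sample.

(* Main.v *)
(* Almost surely every sample point lies in S and the sample is dense in S, so by
   compactness S lies in a small neighbourhood of the first n sample points for large n;
   as these points lie in the hull, which lies in S, the Hausdorff distance tends to 0.
   For the measure, let E be the set of the points of S that no hull contains. A point of
   E is, for each n, close to the apex (or inside) of a cone that avoids the first n sample
   points, so at each scale t <= 1 there is within distance O(t) a ball of radius c t that
   avoids them; letting n grow, the ball of half that radius avoids S, hence E. A set that
   is porous in this uniform way is Lebesgue null: every small cube splits into N^d equal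
   subcubes one of which misses E, and iterating this bounds the measure of E in the cube
   by (1 - N^-d)^k times that of the cube, for every k. Continuity from above of the
   measure nu along the decreasing sets S minus hull then concludes. *)
Require Import Defs.
From HB Require Import structures.
From mathcomp Require Import all_boot all_order all_algebra finmap.
From mathcomp Require Import all_classical all_reals all_analysis measurable_realfun.
From mathcomp Require Import lra ring.

Set Implicit Arguments.
Unset Strict Implicit.
Unset Printing Implicit Defensive.

Import Order.TTheory GRing.Theory Num.Theory.
Import numFieldNormedType.Exports.

Local Open Scope classical_set_scope.
Local Open Scope ring_scope.

Lemma dotpC (R : realType) (d : nat) (x y : 'rV[R]_d) : dotp x y = dotp y x.
Proof. by apply: eq_bigr => i _; rewrite mulrC. Qed.

Lemma dotpDr (R : realType) (d : nat) (x y z : 'rV[R]_d) :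
  dotp x (y + z) = dotp x y + dotp x z.
Proof. by rewrite /dotp -big_split; apply: eq_bigr => i _; rewrite mxE mulrDr. Qed.

Lemma dotpZr (R : realType) (d : nat) (a : R) (x y : 'rV[R]_d) :
  dotp x (a *: y) = a * dotp x y.
Proof. by rewrite /dotp mulr_sumr; apply: eq_bigr => i _; rewrite mxE mulrCA. Qed.

Lemma dotp0r (R : realType) (d : nat) (x : 'rV[R]_d) : dotp x 0 = 0.
Proof. by apply: big1 => i _; rewrite mxE mulr0. Qed.

Lemma dotpDl (R : realType) (d : nat) (x y z : 'rV[R]_d) :
  dotp (x + y) z = dotp x z + dotp y z.
Proof. by rewrite dotpC dotpDr !(dotpC z). Qed.

Lemma dotpZl (R : realType) (d : nat) (a : R) (x y : 'rV[R]_d) :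
  dotp (a *: x) y = a * dotp x y.
Proof. by rewrite dotpC dotpZr dotpC. Qed.

Lemma dotpp_ge0 (R : realType) (d : nat) (x : 'rV[R]_d) : 0 <= dotp x x.
Proof. by apply: sumr_ge0 => i _; rewrite -expr2 sqr_ge0. Qed.

Lemma sqr_enorm (R : realType) (d : nat) (x : 'rV[R]_d) : enorm x ^+ 2 = dotp x x.
Proof. by rewrite sqr_sqrtr// dotpp_ge0. Qed.

Lemma enorm_ge0 (R : realType) (d : nat) (x : 'rV[R]_d) : 0 <= enorm x.
Proof. exact: sqrtr_ge0. Qed.

Lemma normr_coord_le_enorm (R : realType) (d : nat) (x : 'rV[R]_d) i :
  `|x 0 i| <= enorm x.
Proof.
rewrite -(ler_pXn2r (n := 2))// ?nnegrE ?enorm_ge0// sqr_enorm real_normK ?num_real//.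
rewrite /dotp (bigD1 i)//= -expr2 lerDl.
by apply: sumr_ge0 => j _; rewrite -expr2 sqr_ge0.
Qed.

Lemma normr_le_enorm (R : realType) (d : nat) (x : 'rV[R]_d) : `|x| <= enorm x.
Proof.
rewrite /Num.Def.normr/= mx_normrE; apply: bigmax_le; first exact: enorm_ge0.
by case=> i j _; rewrite ord1; exact: normr_coord_le_enorm.
Qed.

Lemma normr_coord_le (R : realType) (d : nat) (x : 'rV[R]_d) i : `|x 0 i| <= `|x|.
Proof.
rewrite [leRHS]/Num.Def.normr/= mx_normrE.
exact: (le_bigmax _ (fun ij => `|x ij.1 ij.2|) (0, i)).
Qed.

Lemma enorm_le_normr (R : realType) (d : nat) (x : 'rV[R]_d) :
  enorm x <= d.+1%:R * `|x|.
Proof.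
rewrite -(ler_pXn2r (n := 2))// ?nnegrE ?enorm_ge0// sqr_enorm.
apply: (@le_trans _ _ (\sum_(i < d) `|x| ^+ 2)).
  apply: ler_sum => i _; rewrite -expr2 -real_normK ?num_real//.
  by rewrite ler_pXn2r ?nnegrE// normr_coord_le.
rewrite sumr_const card_ord exprMn -[leLHS]mulr_natl ler_wpM2r ?sqr_ge0//.
rewrite -natrX ler_nat; apply: (leq_trans (leqnSn d)).
by rewrite expnS expn1 leq_pmulr.
Qed.

Lemma enorm0_eq0 (R : realType) (d : nat) (x : 'rV[R]_d) : enorm x = 0 -> x = 0.
Proof.
by move=> x0; apply/eqP; rewrite -normr_le0 -x0 normr_le_enorm.
Qed.

Lemma enorm0 (R : realType) (d : nat) : enorm (0 : 'rV[R]_d) = 0.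
Proof. by rewrite /enorm dotp0r sqrtr0. Qed.

Lemma enormZ (R : realType) (d : nat) (a : R) (x : 'rV[R]_d) :
  enorm (a *: x) = `|a| * enorm x.
Proof.
by rewrite /enorm dotpZl dotpZr mulrA -expr2 sqrtrM ?sqr_ge0// sqrtr_sqr.
Qed.

Lemma dotp_le_enorm (R : realType) (d : nat) (x y : 'rV[R]_d) :
  dotp x y <= enorm x * enorm y.
Proof.
have [/enorm0_eq0 ->|x0] := eqVneq (enorm x) 0.
  by rewrite dotpC dotp0r enorm0 mul0r.
have [/enorm0_eq0 ->|y0] := eqVneq (enorm y) 0.
  by rewrite dotp0r enorm0 mulr0.
have := dotpp_ge0 (enorm y *: x + (- enorm x) *: y).
rewrite !(dotpDl, dotpDr, dotpZl, dotpZr) (dotpC y x) -!sqr_enorm.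
have : 0 < enorm x by rewrite lt0r x0 enorm_ge0.
have : 0 < enorm y by rewrite lt0r y0 enorm_ge0.
set a := enorm x; set b := enorm y; set c := dotp x y => b_gt0 a_gt0.
rewrite [X in 0 <= X](_ : _ = (a * b * 2) * (a * b - c)); last by ring.
by rewrite pmulr_rge0 ?mulr_gt0// subr_ge0.
Qed.

Lemma enormD (R : realType) (d : nat) (x y : 'rV[R]_d) :
  enorm (x + y) <= enorm x + enorm y.
Proof.
rewrite -(ler_pXn2r (n := 2))// ?nnegrE ?addr_ge0 ?enorm_ge0//.
rewrite sqr_enorm dotpDl !dotpDr -!sqr_enorm (dotpC y x).
by have := dotp_le_enorm x y; lra.
Qed.

Lemma enormN (R : realType) (d : nat) (x : 'rV[R]_d) : enorm (- x) = enorm x.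
Proof. by rewrite -scaleN1r enormZ normrN1 mul1r. Qed.

Lemma enorm_subC (R : realType) (d : nat) (x y : 'rV[R]_d) : enorm (x - y) = enorm (y - x).
Proof. by rewrite -enormN opprB. Qed.

Lemma dotp_ge_enorm (R : realType) (d : nat) (x y : 'rV[R]_d) :
  - (enorm x * enorm y) <= dotp x y.
Proof.
rewrite lerNl -mulN1r -dotpZr; apply: le_trans (dotp_le_enorm _ _) _.
by rewrite enormZ normrN1 mul1r.
Qed.

Lemma continuous_dotp (R : realType) (d : nat) (f g : 'rV[R]_d -> 'rV[R]_d) :
  continuous f -> continuous g -> continuous (fun z => dotp (f z) (g z)).
Proof.
have coordc (u : 'rV[R]_d -> 'rV[R]_d) i : continuous u -> continuous (fun z => u z 0 i).
  move=> cu z; apply: (@continuous_comp _ _ _ u (fun M => M 0 i)); first exact: cu.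
  exact: coord_continuous.
move=> cf cg; apply: continuous_big => [|i _ z]; first exact: add_continuous.
exact: (@continuousM _ _ _ _ z (coordc f i cf z) (coordc g i cg z)).
Qed.

Lemma continuous_enorm (R : realType) (d : nat) (f : 'rV[R]_d -> 'rV[R]_d) :
  continuous f -> continuous (fun z => enorm (f z)).
Proof.
move=> cf z; apply: (@continuous_comp _ _ _ (fun z => dotp (f z) (f z)) Num.sqrt).
  exact: continuous_dotp.
exact: sqrt_continuous.
Qed.

Lemma continuous_subr (R : realType) (d : nat) (x : 'rV[R]_d) :
  continuous (fun z : 'rV[R]_d => z - x).
Proof.
move=> z; apply: (@continuousB _ _ _ id (fun=> x)); last exact: cst_continuous.
exact: cvg_id.
Qed.

Lemma coneE (R : realType) (d : nat) (rho h : R) (xi x z : 'rV[R]_d) :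
  cone rho xi h x z <->
  enorm (z - x) < h /\ cos (rho / 2) * enorm (z - x) < dotp xi (z - x).
Proof.
have [->|zx] := eqVneq z x.
  rewrite subrr enorm0 mulr0 dotp0r ltxx.
  by split=> [[_ [/eqP]]|[]].
have nzx : 0 < enorm (z - x).
  by rewrite lt0r enorm_ge0 andbT; apply: contra_neq zx => /enorm0_eq0/subr0_eq.
rewrite /cone /setI /=; rewrite dotpZr ltr_pdivlMl// (mulrC (enorm _)).
by split=> [[? []]|[]].
Qed.

Lemma open_cone (R : realType) (d : nat) (rho h : R) (xi x : 'rV[R]_d) :
  open (cone rho xi h x).
Proof.
rewrite [X in open X](_ : _ = (fun z => enorm (z - x)) @^-1` [set r | r < h] `&`
  (fun z => dotp xi (z - x) - cos (rho / 2) * enorm (z - x)) @^-1` [set r | 0 < r]).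
  have cdist := continuous_enorm (@continuous_subr _ _ x).
  apply: openI; apply: open_comp; [|exact: open_lt| |exact: open_gt] => z _.
    exact: cdist.
  apply: (@continuousB _ _ _ (fun z : 'rV[R]_d => dotp xi (z - x))
      (fun z => cos (rho / 2) * enorm (z - x))).
    by apply: continuous_dotp => //; [exact: cst_continuous|exact: continuous_subr].
  apply: (@continuousM _ _ (fun=> cos (rho / 2)) (fun z : 'rV[R]_d => enorm (z - x))).
    exact: cst_continuous.
  exact: cdist.
apply/seteqP; split => z.
  by move=> /coneE [? ?]; split => //=; rewrite subr_gt0.
by move=> [? /=]; rewrite subr_gt0 => ?; apply/coneE.
Qed.

Lemma cos_half_lt1 (R : realType) (rho : R) : 0 < rho <= pi -> cos (rho / 2) < 1.
Proof.
by move=> /andP[? ?]; rewrite -[ltRHS]cos0 ltr_cos ?in_itv/=; lra.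
Qed.

(* The truncated cone is convex because [rho <= pi], so it contains a shrunk copy,
   with ratio [t], of its inscribed ball next to each point [y + v] of its closure. *)
Lemma ball_sub_cone (R : realType) (d : nat) (rho h t : R) (xi y v p : 'rV[R]_d) :
  0 < rho <= pi -> 0 < h -> enorm xi = 1 -> 0 < t <= 1 ->
  enorm v <= h -> cos (rho / 2) * enorm v <= dotp xi v ->
  enorm (p - (y + (1 - t) *: v + (t * (h / 2)) *: xi)) < t * (h * (1 - cos (rho / 2)) / 4) ->
  cone rho xi h y p.
Proof.
move=> /andP[rho0 rhopi] h0 xi1 /andP[t0 t1] vh vxi.
have c0 : 0 <= cos (rho / 2) by apply: cos_ge0_pihalf; apply/andP; lra.
move: c0 vxi; set c := cos (rho / 2); set u := p - _ => c0 vxi ur.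
have pE : p - y = (1 - t) *: v + (t * (h / 2)) *: xi + u.
  by rewrite /u opprD opprD !addrA; apply/rowP => i; rewrite !mxE; lra.
clearbody u.
have nxi : enorm ((t * (h / 2)) *: xi) = t * (h / 2).
  by rewrite enormZ xi1 mulr1 ger0_norm// mulr_ge0 ?ltW// divr_gt0.
have nv : enorm ((1 - t) *: v) = (1 - t) * enorm v.
  by rewrite enormZ ger0_norm// subr_ge0.
have npy : enorm (p - y) <= (1 - t) * enorm v + t * (h / 2) + enorm u.
  rewrite pE; apply: le_trans (enormD _ _) _; rewrite lerD2r.
  by apply: le_trans (enormD _ _) _; rewrite nxi nv.
have xixi : dotp xi xi = 1 by rewrite -sqr_enorm xi1 expr1n.
have dpy : (1 - t) * (c * enorm v) + t * (h / 2) - enorm u <= dotp xi (p - y).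
  rewrite pE !dotpDr !dotpZr xixi mulr1; apply: lerD.
    by rewrite lerD2r ler_wpM2l// subr_ge0.
  by have := dotp_ge_enorm xi u; rewrite xi1 mul1r.
have u0 := enorm_ge0 u; have v0 := enorm_ge0 v.
have th0 : 0 < t * h by rewrite mulr_gt0.
have tv : (1 - t) * enorm v <= (1 - t) * h by rewrite ler_wpM2l// subr_ge0.
have c1 : c < 1 by apply: cos_half_lt1; rewrite rho0.
have ct : 0 <= c * (t * h) by rewrite mulr_ge0// ltW.
apply/coneE; split.
  apply: (le_lt_trans npy).
  by move: ur; rewrite (_ : t * (h * (1 - c) / 4) = t * h / 4 - c * (t * h) / 4); [lra|ring].
apply: lt_le_trans dpy; apply: le_lt_trans (ler_wpM2l c0 npy) _.
have cu : c * enorm u <= enorm u by rewrite ler_piMl// ltW.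
by move: ur; rewrite (_ : t * (h * (1 - c) / 4) = t * h / 4 - c * (t * h) / 4); [lra|ring].
Qed.

Lemma closed_cone_hull_compl (R : realType) (d : nat) (rho h : R) (A : set 'rV[R]_d) :
  closed (cone_hull_compl rho h A).
Proof.
apply: closed_bigI => _ [y [xi [_ -> _]]].
by apply: open_closedC; exact: open_cone.
Qed.

Lemma closed_cone_hull (R : realType) (d : nat) (rho h : R) (A : set 'rV[R]_d) :
  closed (cone_hull rho h A).
Proof.
apply: closed_bigI => B [[_ cB _] _].
by apply: compact_closed => //; exact: norm_hausdorff.
Qed.

Lemma sub_cone_hull (R : realType) (d : nat) (rho h : R) (A : set 'rV[R]_d) :
  A `<=` cone_hull rho h A.
Proof. by move=> x Ax B [_ AB]; exact: AB. Qed.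

Lemma sub_cone_hull_compl (R : realType) (d : nat) (rho h : R) (A : set 'rV[R]_d) :
  A `<=` cone_hull_compl rho h A.
Proof.
move=> x Ax _ [y [xi [_ -> /seteqP[CA _]]]] Cx.
by have := CA x; apply.
Qed.

Lemma cone_hullS (R : realType) (d : nat) (rho h : R) (A B : set 'rV[R]_d) :
  A `<=` B -> cone_hull rho h A `<=` cone_hull rho h B.
Proof. by move=> AB x Ax C [cC BC]; apply: Ax; split => //; exact: subset_trans BC. Qed.

Lemma cone_hull_complS (R : realType) (d : nat) (rho h : R) (A B : set 'rV[R]_d) :
  A `<=` B -> cone_hull_compl rho h A `<=` cone_hull_compl rho h B.
Proof.
move=> AB x Ax C [y [xi [xi1 CE CB]]]; apply: Ax; exists y, xi; split => //.
by apply/seteqP; split => // z [Cz Az]; rewrite -CB; split => //; exact: AB.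
Qed.

Lemma near_boundary (R : realType) (d : nat) (B : set 'rV[R]_d) (a x : 'rV[R]_d) :
  compact B -> B a -> ~ B x ->
  exists2 b, boundary B b & enorm (b - x) <= enorm (a - x).
Proof.
move=> cB Ba nBx.
have cf : {within B, continuous (fun b => enorm (b - x))}.
  by apply: continuous_subspaceT; apply: continuous_enorm; exact: continuous_subr.
have [b + bmin] := EVT_min_rV (ex_intro _ a Ba) cB cf.
rewrite inE => Bb; exists b; last by apply: bmin; rewrite inE.
split; first exact: subset_closure.
move=> /nbhs_ballP[e /= e0 beB].
have bx0 : 0 < enorm (b - x).
  rewrite lt0r enorm_ge0 andbT; apply: contra_notN nBx => /eqP/enorm0_eq0/subr0_eq.
  by move=> <-.
pose s := Num.min 1 (e / (2 * enorm (b - x))).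
have s0 : 0 < s by rewrite lt_min ltr01/= divr_gt0// mulr_gt0.
have s1 : s <= 1 by rewrite ge_min lexx.
have Bs : B (b + s *: (x - b)).
  apply: beB; rewrite mx_norm_ball /ball_/= opprD addNKr normrN.
  apply: le_lt_trans (normr_le_enorm _) _; rewrite enormZ gtr0_norm// enorm_subC.
  apply: (@le_lt_trans _ _ (e / (2 * enorm (b - x)) * enorm (b - x))).
    by rewrite ler_wpM2r ?enorm_ge0// ge_min lexx orbT.
  by rewrite invfM mulrA mulfVK ?gt_eqF//; lra.
have := bmin _ (mem_set Bs); apply/negP; rewrite -ltNge.
rewrite (_ : _ - x = (1 - s) *: (b - x)).
  by rewrite enormZ ger0_norm ?subr_ge0// gtr_pMl//; lra.
by apply/rowP => i; rewrite !mxE; ring.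
Qed.

Lemma cone_hull_compl_gap (R : realType) (d : nat) (rho h t : R) (A : set 'rV[R]_d) x :
  0 < rho <= pi -> 0 < h -> 0 < t <= 1 -> ~ cone_hull_compl rho h A x ->
  exists2 z, enorm (z - x) <= t * (2 * h) &
    forall p, enorm (p - z) < t * (h * (1 - cos (rho / 2)) / 4) -> ~ A p.
Proof.
move=> hrho h0 /[dup] ht /andP[t0 t1] /existsNP[_ /not_implyP[[y [xi [xi1 -> CA]]]]].
move=> /contrapT /coneE[xyh xyxi].
exists (y + (1 - t) *: (x - y) + (t * (h / 2)) *: xi) => [|p pz Ap].
  rewrite (_ : _ - x = t *: (y - x) + (t * (h / 2)) *: xi).
    apply: le_trans (enormD _ _) _; rewrite !enormZ xi1 enorm_subC !gtr0_norm ?mulr_gt0//.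
    have := ler_wpM2l (ltW t0) (ltW xyh); have : 0 < t * h by rewrite mulr_gt0.
    by lra.
  by apply/rowP => i; rewrite !mxE; ring.
have : (cone rho xi h y `&` A) p; last by rewrite CA.
by split => //; apply: ball_sub_cone pz => //; exact: ltW.
Qed.

Lemma cone_hull_gap (R : realType) (d : nat) (rho h t : R) (A : set 'rV[R]_d) x a :
  0 < rho <= pi -> 0 < h -> 0 < t <= 1 -> ~ cone_hull rho h A x ->
  A a -> enorm (a - x) <= t * h ->
  exists2 z, enorm (z - x) <= t * (2 * h) &
    forall p, enorm (p - z) < t * (h * (1 - cos (rho / 2)) / 4) -> ~ A p.
Proof.
move=> hrho h0 /[dup] ht /andP[t0 t1] /existsNP[B /not_implyP[[[_ cB bB] AB] nBx]] Aa ax.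
have [b /bB[xi xi1 CB] bx] := near_boundary cB (AB _ Aa) nBx.
have th : 0 < t * h by rewrite mulr_gt0.
exists (b + (1 - t) *: 0 + (t * (h / 2)) *: xi) => [|p pz Ap].
  rewrite scaler0 addr0 addrAC.
  apply: le_trans (enormD _ _) _; rewrite !enormZ xi1 !gtr0_norm ?mulr_gt0//.
  by move: (le_trans bx ax); lra.
apply: (CB p); last exact: AB.
apply: ball_sub_cone pz => //; first by rewrite enorm0 ltW.
by rewrite enorm0 mulr0 dotp0r.
Qed.

Lemma measure_le_sum (dT : measure_display) (T : measurableType dT) (R : realType)
    (mu : {measure set T -> \bar R}) (I : finType) (Q : pred I) (F : I -> set T) (A : set T) :
  (forall i, measurable (F i)) -> measurable A ->
  (forall x, A x -> exists2 i, Q i & F i x) ->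
  (mu A <= \sum_(i | Q i) mu (F i))%E.
Proof.
move=> mF mA AF; apply: (@le_trans _ _ (mu (\big[setU/set0]_(i | Q i) F i))).
  apply: le_measure; rewrite ?inE//; first exact: bigsetU_measurable.
  by move=> x /AF[i Qi Fi]; rewrite (bigD1 i)//=; left.
have [] : measurable (\big[setU/set0]_(i | Q i) F i) /\
    (mu (\big[setU/set0]_(i | Q i) F i) <= \sum_(i | Q i) mu (F i))%E; last by [].
elim/big_rec2 : _ => [|i y1 y2 _ [my le]]; first by rewrite measure0.
split; first exact: measurableU.
by apply: le_trans (measureU2 _ _ _) _ => //; exact: leeD2l.
Qed.

Definition cube (R : realType) (d : nat) (a : 'rV[R]_d) (s : R) : set 'rV[R]_d :=
  [set v | forall i, a 0 i <= v 0 i < a 0 i + s].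

Definition subcube (R : realType) (d : nat) (a : 'rV[R]_d) (s : R) (N : nat)
    (f : {ffun 'I_d -> 'I_N}) : set 'rV[R]_d :=
  cube (a + \row_i ((f i)%:R * (s / N%:R))) (s / N%:R).

Lemma measurable_cube (R : realType) (d : nat) (a : 'rV[R]_d) (s : R) :
  measurable (cube a s).
Proof.
rewrite [X in measurable X](_ : _ = \bigcap_(i in setT)
    ((fun v : 'rV[R]_d => (v 0 i : measurableTypeR R)) @^-1` `[a 0 i, a 0 i + s[)).
  apply: fin_bigcap_measurable => // i _.
  by rewrite -[X in measurable X]setTI; apply: rV_measurable_coord.
apply/seteqP; split=> [v av i _|v av i] /=; first by rewrite in_itv/=; exact: av.
by have := av i I; rewrite /= in_itv.
Qed.

Lemma lebesgue_cube_le (R : realType) (d : nat) (a : 'rV[R]_d) (s : R) : 0 <= s ->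
  (lebesgue_rV R d (cube a s) <= (s ^+ d)%:E)%E.
Proof.
move=> s0; have ab i : a 0 i <= (a + const_mx s) 0 i by rewrite !mxE lerDl.
rewrite [leRHS](_ : _ = (\prod_(i < d) ((a + const_mx s) 0 i - a 0 i))%:E).
  rewrite -lebesgue_rV_box//; apply: le_measure; rewrite ?inE.
  - exact: measurable_cube.
  - rewrite [X in measurable X](_ : _ = \bigcap_(i in setT)
        ((fun v : 'rV[R]_d => (v 0 i : measurableTypeR R)) @^-1`
          `[a 0 i, (a + const_mx s) 0 i])).
      apply: fin_bigcap_measurable => // i _.
      by rewrite -[X in measurable X]setTI; apply: rV_measurable_coord.
    by apply/seteqP; split=> [v Bv i _|v Bv i]; exact: Bv.
  - by move=> v av i; rewrite in_itv/= !mxE; have /andP[-> /ltW ->] := av i.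
congr EFin; under eq_bigr do rewrite !mxE addrC addKr.
by rewrite prodr_const card_ord.
Qed.

Lemma cube_subcube (R : realType) (d : nat) (a v : 'rV[R]_d) (s : R) (n : nat) :
  0 < s -> cube a s v -> exists f : {ffun 'I_d -> 'I_n.+1}, subcube a s f v.
Proof.
move=> s0 av; have e0 : 0 < s / n.+1%:R by rewrite divr_gt0.
exists [ffun i => inord (Num.trunc ((v 0 i - a 0 i) / (s / n.+1%:R)))] => i.
have /andP[avi vai] := av i; rewrite !mxE ffunE.
have q0 : 0 <= (v 0 i - a 0 i) / (s / n.+1%:R) by rewrite divr_ge0 ?subr_ge0// ltW.
have /andP[] := truncn_itv q0; set k := Num.trunc _ => kl kr.
have kn : (k < n.+1)%N.
  rewrite -(ltr_nat R); apply: le_lt_trans kl _; rewrite ltr_pdivrMr//.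
  by rewrite mulrC mulfVK ?pnatr_eq0//; lra.
rewrite inordK//; move: kl kr; rewrite ler_pdivlMr// ltr_pdivrMr// -[k.+1%:R]natr1 mulrDl mul1r.
clearbody k; move: (s / _) => e kl kr; apply/andP; split; lra.
Qed.

Lemma normr_le_coord (R : realType) (d : nat) (x : 'rV[R]_d) (e : R) :
  0 <= e -> (forall i, `|x 0 i| <= e) -> `|x| <= e.
Proof.
move=> e0 xe; rewrite [leLHS]/Num.Def.normr/= mx_normrE.
by apply: bigmax_le => // -[i j] _; rewrite ord1; exact: xe.
Qed.

Definition porous (R : realType) (d : nat) (E : set 'rV[R]_d) (K r : R) :=
  forall x t, E x -> 0 < t <= 1 ->
    exists2 z, `|z - x| <= t * K & forall p, `|p - z| < t * r -> ~ E p.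

Lemma porous_free_subcube (R : realType) (d : nat) (E : set 'rV[R]_d) (K r : R) :
  0 < K -> 0 < r -> porous E K r ->
  exists n, forall a s, 0 < s <= K ->
    exists f : {ffun 'I_d -> 'I_n.+1}, subcube a s f `&` E = set0.
Proof.
move=> K0 r0 hE; pose m := (Num.trunc (2 * K / r)).+1.
have Km : 2 * K < m%:R * r.
  rewrite -ltr_pdivrMr//; have /truncn_itv/andP[//] : 0 <= 2 * K / r.
  by rewrite divr_ge0 ?mulr_ge0// ltW.
have m0 : 0 < m%:R :> R by rewrite ltr0n.
exists (2 * m)%N => a s /andP[s0 sK]; set e := s / (2 * m).+1%:R.
have e0 : 0 < e by rewrite divr_gt0.
have eN : e * (2 * m%:R + 1) = s.
  by rewrite /e -natrM natr1 mulfVK// pnatr_eq0.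
have m2 : (m < (2 * m).+1)%N by rewrite ltnS leq_pmull.
pose f0 : {ffun 'I_d -> 'I_(2 * m).+1} := [ffun=> Ordinal m2].
have [|/set0P[x [fx Ex]]] := eqVneq (subcube a s f0 `&` E) set0; first by exists f0.
pose t := m%:R * e / (2 * K).
have tK : t * K = m%:R * e / 2 by rewrite /t; field; lra.
have me0 : 0 < m%:R * e by rewrite mulr_gt0.
have t0 : 0 < t by rewrite divr_gt0// mulr_gt0.
have t1 : t <= 1 by rewrite ler_pdivrMr ?mulr_gt0//; lra.
have [z zx zE] := hE x t Ex (introT andP (conj t0 t1)).
have [f fz] : exists f : {ffun 'I_d -> 'I_(2 * m).+1}, subcube a s f z.
  apply: cube_subcube => // i; have := fx i; rewrite !mxE ffunE /= -/e.
  have := le_trans (normr_coord_le (z - x) i) zx; rewrite tK !mxE ler_norml.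
  by move=> /andP[? ?] /andP[? ?]; apply/andP; split; lra.
exists f; apply/seteqP; split => // p [fp Ep]; apply: (zE p) => //.
apply: (@le_lt_trans _ _ e).
  apply: normr_le_coord => [|i]; first exact: ltW.
  have := fp i; have := fz i; rewrite !mxE -/e ler_norml.
  by move=> /andP[? ?] /andP[? ?]; apply/andP; split; lra.
rewrite (_ : t * r = e * (m%:R * r) / (2 * K)); last by rewrite /t; ring.
by rewrite ltr_pdivlMr ?mulr_gt0// ltr_pM2l.
Qed.

Lemma porous_cube_le (R : realType) (d : nat) (E : set 'rV[R]_d) (K : R) (n k : nat) a s :
  measurable E ->
  (forall a s, 0 < s <= K ->
    exists f : {ffun 'I_d -> 'I_n.+1}, subcube a s f `&` E = set0) ->
  0 < s <= K ->
  (lebesgue_rV R d (cube a s `&` E) <= (s ^+ d * (1 - (n.+1%:R ^+ d)^-1) ^+ k)%:E)%E.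
Proof.
move=> mE hE; set q := 1 - _.
have n1 : 1 <= n.+1%:R ^+ d :> R by apply: exprn_ege1; rewrite ler1n.
have q0 : 0 <= q by rewrite subr_ge0 invf_le1// (lt_le_trans ltr01 n1).
elim: k a s => [|k IH] a s /andP[s0 sK].
  rewrite expr0 mulr1; apply: le_trans (lebesgue_cube_le a (ltW s0)).
  apply: le_measure; rewrite ?inE; [|exact: measurable_cube|exact: subIsetl].
  by apply: measurableI => //; exact: measurable_cube.
have [f0 f0E] := hE a s (introT andP (conj s0 sK)).
apply: (@le_trans _ _ (\sum_(f | f != f0) lebesgue_rV R d (@subcube _ _ a s n.+1 f `&` E))%E).
  apply: measure_le_sum => [f||x [ax Ex]].
  - by apply: measurableI => //; exact: measurable_cube.
  - by apply: measurableI => //; exact: measurable_cube.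
  have [f fx] := cube_subcube n s0 ax; exists f => //.
  by apply/eqP => ff0; move/seteqP: f0E => [/(_ x)+ _]; apply; rewrite -ff0.
have e0 : 0 < s / n.+1%:R by rewrite divr_gt0.
have eK : s / n.+1%:R <= K.
  by apply: le_trans sK; rewrite ler_pdivrMr// ler_peMr ?(ltW s0) ?ler1n.
apply: (@le_trans _ _ (\sum_(f | f != f0) ((s / n.+1%:R) ^+ d * q ^+ k)%:E)%E).
  by apply: lee_sum => f _; apply: IH; rewrite e0.
rewrite sumEFin lee_fin big_const/= iter_addr addr0.
rewrite (_ : #|_| = (n.+1 ^ d).-1); last first.
  by rewrite cardC1 card_ffun !card_ord.
rewrite -[leLHS]mulr_natl -subn1 natrB ?expn_gt0// natrX exprS /q exprMn exprVn.
rewrite le_eqVlt; apply/orP; left; apply/eqP; field.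
by rewrite expf_neq0// pnatr_eq0.
Qed.

Lemma porous_negligible (R : realType) (d : nat) (E : set 'rV[R]_d) (K r : R) :
  0 < K -> 0 < r -> porous E K r -> measurable E -> bounded_set E ->
  lebesgue_rV R d E = 0%E.
Proof.
move=> K0 r0 hE mE [M [_ bE]]; have [n hn] := porous_free_subcube K0 r0 hE.
set q := 1 - (n.+1%:R ^+ d)^-1 : R.
have n1 : 1 <= n.+1%:R ^+ d :> R by apply: exprn_ege1; rewrite ler1n.
have q01 : `|q| < 1.
  rewrite ger0_norm ?subr_ge0 ?invf_le1 ?(lt_le_trans ltr01)//.
  by rewrite ltrBlDr ltrDl invr_gt0 (lt_le_trans ltr01).
have small a s : 0 < s <= K -> lebesgue_rV R d (cube a s `&` E) = 0%E.
  move=> sK; apply/eqP; rewrite -measure_le0.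
  have cq : (s ^+ d * q ^+ k)%:E @[k --> \oo] --> (0 : R)%:E.
    apply: cvg_EFin; first exact: nearW.
    exact: cvg_geometric.
  by apply: cvge_ge cq; apply: nearW => k; exact: (porous_cube_le k a mE hn sK).
pose L := Num.max 1 (M + 2).
have L0 : 0 < 2 * L by rewrite mulr_gt0// lt_max ltr01.
pose N := Num.trunc (2 * L / K).
have LN : 0 < 2 * L / N.+1%:R <= K.
  rewrite divr_gt0//= ler_pdivrMr// (mulrC K) -ler_pdivrMr//; apply: ltW.
  suff /truncn_itv/andP[] : 0 <= 2 * L / K by [].
  by rewrite divr_ge0// ltW.
pose a : 'rV[R]_d := const_mx (- L).
have EL : E `<=` cube a (2 * L).
  move=> x Ex i;
  have xL : `|x| < L.
    have /bE/(_ _ Ex)/= xM : M < M + 1 by rewrite ltrDl.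
    by rewrite lt_max; apply/orP; right; apply: le_lt_trans xM _; rewrite ltrD2l ltr1n.
  have := le_lt_trans (normr_coord_le x i) xL; rewrite !mxE ltr_norml.
  by move=> /andP[? ?]; apply/andP; split; lra.
apply/eqP; rewrite -measure_le0.
rewrite (_ : 0%E = \sum_(f : {ffun 'I_d -> 'I_N.+1}) 
  lebesgue_rV R d (subcube a (2 * L)%R f `&` E))%E.
  apply: measure_le_sum => [f||x Ex] //.
    by apply: measurableI => //; exact: measurable_cube.
  by have [f fx] := cube_subcube N L0 (EL _ Ex); exists f.
by rewrite big1// => f _; exact: small.
Qed.

Definition rat_ball (R : realType) (d : nat) (p : 'rV[rat]_d * rat) : set 'rV[R]_d :=
  ball (map_mx ratr p.1 : 'rV[R]_d) (ratr p.2).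

Lemma open_rat_ball (R : realType) (d : nat) p : open (@rat_ball R d p).
Proof. exact: ball_open. Qed.

Lemma rat_ball_sub (R : realType) (d : nat) (U : set 'rV[R]_d) (x : 'rV[R]_d) :
  open U -> U x -> exists2 p, rat_ball p x & rat_ball p `<=` U.
Proof.
move=> oU Ux; have : nbhs x U by exact: open_nbhs_nbhs.
move=> /nbhs_ballP[e /= e0 xeU].
have [r /andP[r0 re]] : exists r : rat, (0 : R) < ratr r < e / 2.
  have /rat_in_itvoo[r] : (0 : R) < e / 2 by rewrite divr_gt0.
  by rewrite in_itv /= => ?; exists r.
have [q qP] : {q : 'I_d -> rat & forall i, `|x 0 i - ratr (q i)| < ratr r / 2}.
  apply: (@choice _ _ (fun i y => `|x 0 i - ratr y| < ratr r / 2)) => i.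
  have /rat_in_itvoo[q] : x 0 i - ratr r / 2 < x 0 i + ratr r / 2 by lra.
  by rewrite in_itv /= => qv; exists q; rewrite ltr_distlC.
have qx : `|map_mx ratr (\row_i q i) - x| <= ratr r / 2 :> R.
  apply: normr_le_coord => [|i]; first by rewrite divr_ge0// ltW.
  by rewrite !mxE distrC ltW// qP.
exists (\row_i q i, r); rewrite /rat_ball mx_norm_ball /ball_/=.
  by apply: le_lt_trans qx _; lra.
move=> y /= yq; apply: xeU; rewrite mx_norm_ball /ball_/=.
rewrite -(subrK (map_mx ratr (\row_i q i)) x) -addrA.
by apply: le_lt_trans (ler_normD _ _) _; rewrite distrC; lra.
Qed.

Lemma ae_forall_countable (dT : measure_display) (T : measurableType dT) (R : realType)
    (mu : {measure set T -> \bar R}) (I : countType) (Q : I -> T -> Prop) :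
  (forall i, {ae mu, forall x, Q i x}) -> {ae mu, forall x, forall i, Q i x}.
Proof.
move=> aeQ; have : {ae mu, forall x, forall n,
    if @choice.unpickle I n is Some i then Q i x else True}.
  apply: ae_foralln => n; case: choice.unpickle => [i|]; first exact: aeQ.
  exact: aeW.
by apply: filterS => x Qx i; have := Qx (choice.pickle i); rewrite choice.pickleK.
Qed.

Lemma measure_support_ae (R : realType) (d : nat) (P : {measure set 'rV[R]_d -> \bar R}) :
  {ae P, forall v, measure_support P v}.
Proof.
have : {ae P, forall v, forall p, P (rat_ball p) = 0%E -> ~ rat_ball p v}.
  apply: ae_forall_countable => p; have [Pp|Pp] := pselect (P (rat_ball p) = 0%E).
    exists (rat_ball p); split => //; first by apply: rV_open_measurable; exact: open_rat_ball.
    by move=> v /= /not_implyP[_ /contrapT].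
  by apply: aeW.
apply: filterS => v Pv U oU Uv; have [p pv pU] := rat_ball_sub oU Uv.
apply: (@lt_le_trans _ _ (P (rat_ball p))).
  by rewrite lt0e measure_ge0 andbT; apply/eqP => /Pv.
have op := @open_rat_ball R d p.
by apply: le_measure; rewrite ?inE//; exact: rV_open_measurable.
Qed.

Section random_sample_lemmas.
Context {R : realType} {dO dT : measure_display} {Omega : measurableType dO}
  {T : measurableType dT} {Pr : probability Omega R} {P : probability T R}.
Variable X : nat -> {RV Pr >-> T}.
Hypothesis hX : iid_with_law P X.

Lemma ae_all_sample (Q : set T) : {ae P, forall v, Q v} ->
  {ae Pr, forall w, forall i, Q (X i w)}.
Proof.
move=> [N [mN PN NQ]]; apply: ae_foralln => i; exists (X i @^-1` N); split.
- by rewrite -[X in measurable X]setTI; exact: measurable_funPT.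
- by rewrite -[RHS]PN -(hX.2 i).
- by move=> w nQ; exact: NQ.
Qed.

Lemma ae_sample_hits (B : set T) : measurable B -> (0 < P B)%E ->
  {ae Pr, forall w, exists i, B (X i w)}.
Proof.
move=> mB PB; have mX i C : measurable C -> measurable (X i @^-1` C).
  by move=> mC; rewrite -[X in measurable X]setTI; exact: measurable_funPT.
pose N := \bigcap_i (X i @^-1` (~` B)).
have mN : measurable N.
  by apply: bigcapT_measurable => i; apply: mX; exact: measurableC.
exists N; split => //; last first.
  by move=> w /= nB i _ /= Bi; apply: nB; exists i.
pose c := fine (P (~` B)).
have cE : P (~` B) = c%:E by rewrite fineK// fin_num_measure//; exact: measurableC.
have c1 : `|c| < 1.
  rewrite ger0_norm ?fine_ge0// -lte_fin -cE probability_setC//.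
  by rewrite lteBlDr ?fin_num_measure// lteDl.
have Nc n : (Pr N <= (c ^+ n)%:E)%E.
  pose J := [fset i in iota 0 n]%fset.
  apply: (@le_trans _ _ (Pr (\bigcap_(i in [set` J]) (X i @^-1` (~` B))))).
    apply: le_measure; rewrite ?inE//.
      by apply: fin_bigcap_measurable => // i _; apply: mX; exact: measurableC.
    by move=> w Nw i _; exact: Nw.
  rewrite (hX.1 J (fun=> ~` B)); last by move=> _; exact: measurableC.
  rewrite (eq_bigr (fun=> c%:E)); last by move=> i _; rewrite -cE -(hX.2 i)//; exact: measurableC.
  rewrite prodEFin lee_fin big_const_seq count_predT iter_mulr mulr1.
  by rewrite card_fseq undup_id ?iota_uniq// size_iota.
apply/eqP; rewrite -measure_le0.
have cq : (c ^+ n)%:E @[n --> \oo] --> (0 : R)%:E.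
  by apply: cvg_EFin; [exact: nearW|exact: cvg_expr].
by apply: cvge_ge cq; exact: nearW.
Qed.

End random_sample_lemmas.

Lemma ae_sample_dense (R : realType) (d : nat) (dO : measure_display)
    (Omega : measurableType dO) (Pr : probability Omega R) (P : probability 'rV[R]_d R)
    (X : nat -> {RV Pr >-> 'rV[R]_d}) : iid_with_law P X ->
  {ae Pr, forall w, forall x e, measure_support P x -> 0 < e ->
    exists i, enorm (X i w - x) < e}.
Proof.
move=> hX.
have : {ae Pr, forall w, forall p, (0 < P (rat_ball p))%E -> exists i, rat_ball p (X i w)}.
  apply: ae_forall_countable => p; have [Pp|Pp] := pselect (0 < P (rat_ball p))%E.
    apply: filterS (ae_sample_hits hX _ Pp) => [w + _|] //.
    by apply: rV_open_measurable; exact: open_rat_ball.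
  by apply: aeW.
apply: filterS => w Xw x e Sx e0; have e1 : 0 < e / d.+1%:R by rewrite divr_gt0.
have [p px pe] := rat_ball_sub (ball_open x (e / d.+1%:R)) (ballxx x e1).
have [i ip] := Xw p (Sx _ (@open_rat_ball R d p) px); exists i.
apply: le_lt_trans (enorm_le_normr _) _; rewrite mulrC -ltr_pdivlMr// distrC.
by have := pe _ ip; rewrite mx_norm_ball.
Qed.

Lemma compact_uniform_net (R : realType) (d : nat) (S : set 'rV[R]_d)
    (u : nat -> 'rV[R]_d) (e : R) :
  compact S -> (forall x e, S x -> 0 < e -> exists i, enorm (u i - x) < e) -> 0 < e ->
  \forall n \near \oo, forall x, S x -> exists2 i, (i < n)%N & enorm (u i - x) < e.
Proof.
move=> /compact_near_coveringP cS du e0.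
apply: (cS _ _ (fun n x => exists2 i, (i < n)%N & enorm (u i - x) < e)) => x Sx.
have e2 : 0 < e / 2 by rewrite divr_gt0.
have [i ui] := du x _ Sx e2.
have e3 : 0 < e / 2 / d.+1%:R by rewrite divr_gt0.
exists (ball x (e / 2 / d.+1%:R), [set n | (i < n)%N]).
  by split; [exact: nbhsx_ballx|exists i.+1].
move=> [y n] /= [xy ltin]; exists i => //.
rewrite -(subrK x (u i)) -addrA; apply: le_lt_trans (enormD _ _) _.
have : enorm (x - y) < e / 2.
  apply: le_lt_trans (enorm_le_normr _) _; rewrite mulrC -ltr_pdivlMr//.
  by move: xy; rewrite mx_norm_ball.
by lra.
Qed.

(* Unqualified, [edist] would be the extended distance of mathcomp-analysis. *)
Lemma edist_ge0 (R : realType) (d : nat) (x : 'rV[R]_d) (A : set 'rV[R]_d) :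
  (0 <= Defs.edist x A)%E.
Proof. by apply: le_ereal_inf_tmp => _ [y Ay <-]; rewrite lee_fin enorm_ge0. Qed.

Lemma edist_le (R : realType) (d : nat) (x y : 'rV[R]_d) (A : set 'rV[R]_d) :
  A y -> (Defs.edist x A <= (enorm (x - y))%:E)%E.
Proof. by move=> Ay; apply: ereal_inf_lbound; exists y. Qed.

Lemma hausdorff_dist_ge0 (R : realType) (d : nat) (A C : set 'rV[R]_d) :
  C !=set0 -> (0 <= hausdorff_dist A C)%E.
Proof.
move=> [x Cx]; rewrite /hausdorff_dist le_max; apply/orP; right.
by apply: le_trans (edist_ge0 x A) _; apply: ereal_sup_ubound; exists x.
Qed.

Lemma hausdorff_dist_subset_le (R : realType) (d : nat) (A C : set 'rV[R]_d) (e : R) :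
  0 <= e -> A `<=` C -> (forall x, C x -> exists2 y, A y & enorm (y - x) <= e) ->
  (hausdorff_dist A C <= e%:E)%E.
Proof.
move=> e0 AC CA; rewrite /hausdorff_dist ge_max; apply/andP; split.
  apply: ge_ereal_sup => _ [x Ax <-]; apply: le_trans (edist_le x (AC _ Ax)) _.
  by rewrite subrr enorm0 lee_fin.
apply: ge_ereal_sup => _ [x Cx <-]; have [y Ay yx] := CA x Cx.
by apply: le_trans (edist_le x Ay) _; rewrite lee_fin enorm_subC.
Qed.

Lemma rV_closed_measurable (R : realType) (d : nat) (A : set 'rV[R]_d) :
  closed A -> measurable A.
Proof.
move=> cA; rewrite -[A]setCK; apply: measurableC; apply: rV_open_measurable.
exact: closed_openC.
Qed.

Lemma rV_compact_measurable (R : realType) (d : nat) (A : set 'rV[R]_d) :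
  compact A -> measurable A.
Proof.
by move=> cA; apply: rV_closed_measurable; apply: compact_closed => //; exact: norm_hausdorff.
Qed.

Section growing_hulls.
Context {R : realType} {d : nat}.
Variables (S : set 'rV[R]_d) (u : nat -> 'rV[R]_d) (H : nat -> set 'rV[R]_d).
Hypothesis cS : compact S.
Hypothesis uS : forall i, S (u i).
Hypothesis du : forall x e, S x -> 0 < e -> exists i, enorm (u i - x) < e.
Hypothesis uH : forall n, [set u i | i in `I_n] `<=` H n.
Hypothesis HS : forall n, H n `<=` S.

Lemma hausdorff_dist_hull_cvg0 : hausdorff_dist (H n) S @[n --> \oo] --> 0%E.
Proof.
have S0 : S !=set0 by exists (u 0%N).
have near_le (e : R) : 0 < e -> \forall n \near \oo, (hausdorff_dist (H n) S <= e%:E)%E.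
  move=> e0; apply: filterS (compact_uniform_net cS du e0) => n un.
  apply: hausdorff_dist_subset_le => [|//|x Sx]; first exact: ltW.
  by have [i ltin uix] := un x Sx; exists (u i); [apply: uH; exists i|exact: ltW].
apply/fine_cvgP; split.
  apply: filterS (near_le 1 ltr01) => n hle.
  by rewrite ge0_fin_numE ?hausdorff_dist_ge0// (le_lt_trans hle) ?ltry.
apply/cvgr0Pnorm_le => e e0; apply: filterS (near_le e e0) => n hle.
have h0 := hausdorff_dist_ge0 (H n) S0.
rewrite /= ger0_norm ?fine_ge0// -lee_fin fineK//.
by rewrite ge0_fin_numE// (le_lt_trans hle) ?ltry.
Qed.

Hypothesis HH : forall m n, (m <= n)%N -> H m `<=` H n.
Hypothesis clH : forall n, closed (H n).

Let measurable_diff n : measurable (S `\` H n).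
Proof. by apply: measurableD; [exact: rV_compact_measurable|exact: rV_closed_measurable]. Qed.

Let measurable_missed : measurable (\bigcap_n (S `\` H n)).
Proof. by apply: bigcapT_measurable => n; exact: measurable_diff. Qed.

Lemma measure_dist_hull_cvg0 (nu : {measure set 'rV[R]_d -> \bar R}) :
  (nu S < +oo)%E -> nu (\bigcap_n (S `\` H n)) = 0%E ->
  measure_dist nu (H n) S @[n --> \oo] --> 0%E.
Proof.
move=> nuS nu0.
rewrite [X in X @ _](_ : _ = nu \o (fun n => S `\` H n)); last first.
  apply/funext => n; rewrite /measure_dist /= (_ : H n `\` S = set0) ?measure0 ?add0e//.
  by apply/seteqP; split => // x [/HS].
rewrite -nu0; apply: nonincreasing_cvg_mu => //.
  apply: le_lt_trans nuS; apply: le_measure; rewrite ?inE//.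
  exact: rV_compact_measurable.
by move=> m n mn; apply/subsetPset => x [Sx nHx]; split => // /(HH mn).
Qed.

Variables (K l r : R).
Hypotheses (K0 : 0 < K) (l0 : 0 < l) (r0 : 0 < r).
Hypothesis gap : forall n x t i, 0 < t <= 1 -> ~ H n x -> (i < n)%N ->
  enorm (u i - x) <= t * l ->
  exists2 z, enorm (z - x) <= t * K & forall p, enorm (p - z) < t * r ->
    ~ [set u i | i in `I_n] p.

Lemma porous_missed : porous (\bigcap_n (S `\` H n)) K (r / 2 / d.+1%:R).
Proof.
move=> x t Ex /[dup] t01 /andP[t0 t1].
have e0 : 0 < Num.min (t * (r / 2)) (t * l) by rewrite lt_min !mulr_gt0// divr_gt0.
have [n _ un] := compact_uniform_net cS du e0.
have [Sx nHx] := Ex n I.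
have [i ltin] := un n (leqnn n) x Sx; rewrite lt_min => /andP[_ /ltW uix].
have [z zx zA] := gap t01 nHx ltin uix.
exists z; first exact: le_trans (normr_le_enorm _) zx.
move=> p pz Ep; have [Sp _] := Ep n I.
have [j ltjn] := un n (leqnn n) p Sp; rewrite lt_min => /andP[ujp _].
apply: (zA (u j)); last by exists j.
rewrite -(subrK p (u j)) -addrA; apply: le_lt_trans (enormD _ _) _.
have : enorm (p - z) < t * (r / 2).
  by apply: le_lt_trans (enorm_le_normr _) _; rewrite mulrC -ltr_pdivlMr// -mulrA.
by lra.
Qed.

Lemma lebesgue_missed : lebesgue_rV R d (\bigcap_n (S `\` H n)) = 0%E.
Proof.
have r1 : 0 < r / 2 / d.+1%:R by rewrite !divr_gt0.
apply: (porous_negligible K0 r1 porous_missed) => //.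
have [M [rM bM]] := compact_bounded cS; exists M; split => // y My x Ex.
by apply: bM My _ _; have [] := Ex 0%N I.
Qed.

Lemma measure_dist_hull_ac_cvg0 (P nu : {measure set 'rV[R]_d -> \bar R}) :
  P `<< lebesgue_rV R d -> (nu S < +oo)%E ->
  (fun A : set 'rV[R]_d => nu (A `&` S)) `<< P ->
  measure_dist nu (H n) S @[n --> \oo] --> 0%E.
Proof.
move=> /null_content_dominatesP Pac nuS /null_content_dominatesP nuP.
apply: measure_dist_hull_cvg0 => //.
rewrite -[X in nu X](_ : \bigcap_n (S `\` H n) `&` S = _).
  by apply: nuP => //; apply: Pac => //; exact: lebesgue_missed.
by apply/setIidPl => x Ex; have [] := Ex 0%N I.
Qed.

End growing_hulls.

Theorem theorem4 (R : realType) (d : nat) (rho h : R)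
    (hrho : 0 < rho <= pi) (hh : 0 < h)
    (P : probability 'rV[R]_d R) (hP : P `<< lebesgue_rV R d)
    (S : set 'rV[R]_d) (hS : S = measure_support P) (cS : compact S)
    (dO : measure_display) (Omega : measurableType dO) (Pr : probability Omega R)
    (X : nat -> {RV Pr >-> 'rV[R]_d}) (hX : iid_with_law P X)
    (nu : {measure set 'rV[R]_d -> \bar R})
    (nu_fin : forall K : set 'rV[R]_d, compact K -> (nu K < +oo)%E)
    (nu_ac : (fun A : set 'rV[R]_d => nu (A `&` S)) `<< P) :
  (cone_convex rho h S ->
     {ae Pr, forall w,
       hausdorff_dist (cone_hull rho h (sample X n w)) S @[n --> \oo] --> 0%E} /\
     {ae Pr, forall w,
       measure_dist nu (cone_hull rho h (sample X n w)) S @[n --> \oo] --> 0%E}) /\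
  (cone_convex_compl rho h S ->
     {ae Pr, forall w,
       hausdorff_dist (cone_hull_compl rho h (sample X n w)) S @[n --> \oo] --> 0%E} /\
     {ae Pr, forall w,
       measure_dist nu (cone_hull_compl rho h (sample X n w)) S @[n --> \oo] --> 0%E}).
Proof.
have r0 : 0 < h * (1 - cos (rho / 2)) / 4.
  by rewrite divr_gt0// mulr_gt0// subr_gt0 cos_half_lt1.
have XS : {ae Pr, forall w, forall i, S (X i w)}.
  by rewrite hS; exact/(ae_all_sample hX)/measure_support_ae.
have Xd := ae_sample_dense hX; rewrite -hS in Xd.
have XSd : {ae Pr, forall w, (forall i, S (X i w)) /\
    forall x e, S x -> 0 < e -> exists i, enorm (X i w - x) < e} by exact: filterI.
have sampleS w m n : (m <= n)%N -> sample X m w `<=` sample X n w.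
  by move=> mn _ [i /= im <-]; exists i => //=; exact: leq_trans mn.
have h2 : 0 < 2 * h by rewrite mulr_gt0.
split => [cvxS|[S0 _ SE]].
  have HS w : (forall i, S (X i w)) -> forall n, cone_hull rho h (sample X n w) `<=` S.
    by move=> XwS n x; apply; split => // _ [i _ <-].
  split; apply: filterS XSd => w [XwS Xwd].
    by apply: (hausdorff_dist_hull_cvg0 cS XwS Xwd) => n; [exact: sub_cone_hull|exact: HS].
  apply: (measure_dist_hull_ac_cvg0 cS Xwd (HS _ XwS) _ _ h2 hh r0 _ hP (nu_fin _ cS) nu_ac).
  - by move=> m n mn; apply: cone_hullS; exact: sampleS.
  - by move=> n; exact: closed_cone_hull.
  - by move=> n x t i t01 nx ltin; apply: cone_hull_gap => //; exists i.
have HS w : (forall i, S (X i w)) -> forall n, cone_hull_compl rho h (sample X n w) `<=` S.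
  by move=> XwS n; rewrite [X in _ `<=` X]SE; apply: cone_hull_complS => _ [i _ <-].
split; apply: filterS XSd => w [XwS Xwd].
  by apply: (hausdorff_dist_hull_cvg0 cS XwS Xwd) => n; [exact: sub_cone_hull_compl|exact: HS].
apply: (measure_dist_hull_ac_cvg0 cS Xwd (HS _ XwS) _ _ h2 hh r0 _ hP (nu_fin _ cS) nu_ac).
- by move=> m n mn; apply: cone_hull_complS; exact: sampleS.
- by move=> n; exact: closed_cone_hull_compl.
- by move=> n x t i t01 nx ltin _; exact: cone_hull_compl_gap.
Qed.
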